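(* Let $n\ge 0$ and $k\ge 1$ be integers. The map $f$ is a bijection from the set $\mathcal{S}_{n,k}$ of $k$-ary faro words of length $n$ to the set $\mathcal{B}_{n+2(k-1),k-1}$ of dispersed Dyck paths of length $n+2(k-1)$ with exactly $k-1$ peaks.
   Context: Faro words: a $k$-ary word is a word over $\{1,\dots,k\}$. A $k$-ary faro word of length $n$ is a word $u_1v_1u_2v_2u_3v_3\cdots$ of length $n=|u|+|v|$ obtained by interlacing two nondecreasing $k$-ary words $u,v$ with $0\le |u|-|v|\le 1$ (equivalently, $w_i\le w_{i+2}$ for all $1\le i\le n-2$). Blocks: a pair in a faro word $w$ is an occurrence of two consecutive letters $w_iw_{i+1}$ with $w_i>w_{i+1}$; no letter belongs to two pairs. A singleton is a letter $w_i$ (at a position) not belonging to any pair. Paths: a dispersed Dyck path of length $n$ is a lattice path from $(0,0)$ to $(n,0)$ with steps $F=(1,0)$, $U=(1,1)$, $D=(1,-1)$, never going below the $x$-axis, all of whose level steps $F$ lie on the $x$-axis. A peak is an occurrence of $UD$ as two consecutive steps. The map $f$ (depends on $k$): for a $k$-ary faro word $w$ of length $n$, $$f(w)=F^{T_0}U^{T_1}D^{T_2}F^{T_3}U^{T_4}D^{T_5}\cdots F^{T_{3(k-2)}}U^{T_{3(k-2)+1}}D^{T_{3(k-2)+2}}F^{T_{3(k-1)}},$$ where $T_{3(x-1)}$ ($1\le x\le k$) is the number of occurrences of the singleton $x$ in $w$; $T_{3(x-1)-1}$ ($2\le x\le k$) is one plus the number of pairs $xy$ with $y<x$ in $w$;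 $T_{3(x-1)+1}$ ($1\le x\le k-1$) is one plus the number of pairs $yx$ with $y>x$ in $w$. (For $k=1$, $f(w)=F^{T_0}$.) *)

(* Defs.v *)
From mathcomp Require Import all_boot all_order all_algebra.
From mathcomp Require Import classical_sets functions.

Set Implicit Arguments.
Unset Strict Implicit.
Unset Printing Implicit Defensive.

Import GRing.Theory.

Local Open Scope classical_set_scope.

Definition kary (k : nat) (w : seq nat) : bool :=
  all (fun x => 1 <= x <= k) w.

(* u_1 v_1 u_2 v_2 ... ; once one word is exhausted, the rest of the other one
   follows. For 0 <= |u| - |v| <= 1 this rest has at most one letter. *)
Fixpoint interlace (u v : seq nat) : seq nat :=
  match u, v with
  | a :: u', b :: v' => [:: a, b & interlace u' v']
  | [::], _ => v
  | _, [::] => u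
  end.

Definition faro_words (n k : nat) : set (seq nat) :=
  [set w | exists u v : seq nat,
     [/\ kary k u /\ kary k v,
         sorted leq u /\ sorted leq v,
         size v <= size u <= (size v).+1,
         w = interlace u v
       & size w = n]].

(* Positions are numbered from 0. *)
Definition pair_at (w : seq nat) (i : nat) : bool :=
  (i.+1 < size w) && (nth 0 w i.+1 < nth 0 w i).

Definition singleton_at (w : seq nat) (i : nat) : bool :=
  [&& i < size w, ~~ pair_at w i & ~~ ((0 < i) && pair_at w i.-1)].

Definition nb_singletons (w : seq nat) (x : nat) : nat :=
  count (fun i => singleton_at w i && (nth 0 w i == x)) (iota 0 (size w)).

(* number of pairs xy with y < x *)
Definition nb_pairs_from (w : seq nat) (x : nat) : nat :=
  count (fun i => pair_at w i && (nth 0 w i == x)) (iota 0 (size w)).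

(* number of pairs yx with y > x *)
Definition nb_pairs_to (w : seq nat) (x : nat) : nat :=
  count (fun i => pair_at w i && (nth 0 w i.+1 == x)) (iota 0 (size w)).

Inductive step : Type := F | U | D.

Definition step_vec (s : step) : int * int :=
  match s with
  | F => (1, 0)
  | U => (1, 1)
  | D => (1, -1)
  end%R.

Definition endpoint (p : seq step) : int * int := (\sum_(s <- p) step_vec s)%R.

Definition nb_peaks (p : seq step) : nat :=
  count (fun st => if st is (U, D) then true else false) (zip p (behead p)).

(* Dispersed Dyck paths of length m with exactly r peaks. *)
Definition dispersed_dyck_paths (m r : nat) : set (seq step) :=
  [set p | [/\ endpoint p = (m%:Z, 0)%R,
               forall i, i <= size p -> (0 <= (endpoint (take i p)).2)%R,
               forall i, i < size p -> nth F p i = F ->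
                 (endpoint (take i p)).2 = 0%R
             & nb_peaks p = r]].

(* For m = 3q, 3q + 1, 3q + 2 the number T_m concerns the singletons q+1, the
   pairs y(q+1) with y > q+1, and the pairs (q+2)y with y < q+2. *)
Definition T (w : seq nat) (m : nat) : nat :=
  match m %% 3 with
  | 0 => nb_singletons w (m %/ 3).+1
  | 1 => (nb_pairs_to w (m %/ 3).+1).+1
  | _ => (nb_pairs_from w (m %/ 3).+2).+1
  end.

(* Used for k >= 1 only. *)
Definition faro_map (k : nat) (w : seq nat) : seq step :=
  flatten [seq nseq (T w (3 * j)) F ++ nseq (T w (3 * j + 1)) U
                 ++ nseq (T w (3 * j + 2)) D | j <- iota 0 (k - 1)]
  ++ nseq (T w (3 * (k - 1))) F.

(* Main.v *)
Require Import Defs.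
From mathcomp Require Import all_boot all_order all_algebra.
From mathcomp Require Import classical_sets functions.
From mathcomp Require Import zify.

(** The word is a sequence of blocks, a block being a singleton x, written
    (x, x), or a pair hi lo with lo < hi, written (lo, hi). The inequalities
    w_i <= w_(i+2) say exactly that both coordinates of the blocks are
    nondecreasing ([faro_word], [faro_wordP]), so a faro word is a chain in the
    product order. The exponents of the path record, for each letter x, how
    many blocks are (x, x), how many pairs have low letter x and how many pairs
    have high letter x.

    Injectivity: these numbers determine how often each letter occurs as a low
    letter of a block and as a high letter of a block. Since the low letters
    and the high letters are both sorted, they determine the two sequences of
    coordinates, hence the chain ([block_chain_inj]).

    The image consists of dispersed Dyck paths: just before the run of F that
    belongs to x, the height of the path is the number of pairs with
    lo < x < hi ([straddlingS]). It is nonnegative, and it vanishes as soon as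
    (x, x) is a block, because such a pair is incomparable with (x, x)
    ([singleton_not_straddled]).

    Surjectivity: a dispersed Dyck path has the shape
    F^a0 U^(b0+1) D^(c0+1) F^a1 ..., with one UD per peak ([dyck_runs]), since F
    never meets a positive height. Read it with a first-in first-out queue of
    low letters: F emits a singleton x, all but one of the U in a run push x,
    all but one of the D in a run pop a letter y and emit the pair (y, x+1).
    The length of the queue is the height of the path, so no pop fails and the
    queue is empty when a singleton is emitted; being first-in first-out, the
    queue emits its letters in sorted order, so the blocks form a chain, and
    their numbers are the exponents that were read ([profile_queue_blocks]).

    The length of the word need not be followed through the construction: the
    length of the path is the number of letters plus 2(k-1)
    ([size_faro_map]). *)

Set Implicit Arguments.
Unset Strict Implicit.
Unset Printing Implicit Defensive.

(** * Faro words as interlacings *)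

Fixpoint faro (w : seq nat) : bool :=
  if w is a :: w' then
    (if w' is _ :: c :: _ then a <= c else true) && faro w'
  else true.

(** Exchanging the roles of the two words at each letter turns the two-letter
    recursion of [interlace] into a recursion on single letters, which is the
    one that [faro] follows. *)
Lemma interlace_cons a u v :
  size v <= (size u).+1 <= (size v).+1 ->
  interlace (a :: u) v = a :: interlace v u.
Proof.
elim: v a u => [|b v IHv] a [|c u] //=.
by move=> sz; rewrite -/(interlace (c :: u) v) IHv.
Qed.

Lemma all_interlace (P : pred nat) u v :
  all P (interlace u v) = all P u && all P v.
Proof.
elim: u v => [|a u IHu] [|b v] //=; first by rewrite andbT.
by rewrite IHu; do 2 case: (P _) => //=; rewrite andbF.
Qed.

Lemma faro_interlace u v :
  size v <= size u <= (size v).+1 -> sorted leq u -> sorted leq v ->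
  faro (interlace u v).
Proof.
have [m] := ubnP (size u + size v).
elim: m u v => // m IHm [|a u] v szm sz su sv; first by case: v sz {sv szm}.
rewrite interlace_cons //= IHm //=; last 3 first.
- by rewrite /= in szm; lia.
- by rewrite /= in sz; lia.
- exact: path_sorted su.
rewrite andbT; case: v sz {sv szm} => [|b v] sz; first by case: u sz {su}.
rewrite interlace_cons; last by rewrite /= in sz; lia.
case: u su sz => [|c u] /=; first by case: v.
by case: v => [|d v] /= /andP[].
Qed.

Lemma faro_interlaceP w : faro w ->
  exists u v, [/\ size v <= size u <= (size v).+1,
                  sorted leq u, sorted leq v & w = interlace u v].
Proof.
elim: w => [|a w IHw] /=; first by exists [::], [::].
case/andP=> aw /IHw[u [v [sz su sv wE]]].
exists (a :: v), u; split=> //; first by rewrite /=; lia.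
  2: by rewrite interlace_cons -?wE //; lia.
case: v sz sv wE => //= c v; case: u su => [|b u] //= _ sz sv wE.
by rewrite sv andbT; move: aw; rewrite wE.
Qed.

(** * Faro words as chains of blocks *)

Definition block_le (b c : nat * nat) : bool := (b.1 <= c.1) && (b.2 <= c.2).

Definition block_chain (bs : seq (nat * nat)) : bool :=
  all (fun b => b.1 <= b.2) bs && sorted block_le bs.

Definition block_word (b : nat * nat) : seq nat :=
  if b.1 < b.2 then [:: b.2; b.1] else [:: b.2].

Definition word (bs : seq (nat * nat)) : seq nat := flatten (map block_word bs).

Lemma word_cons b bs : word (b :: bs) = block_word b ++ word bs.
Proof. by []. Qed.

Lemma block_word_singleton a : block_word (a, a) = [:: a].
Proof. by rewrite /block_word ltnn. Qed.

Lemma block_word_pair a b : b < a -> block_word (b, a) = [:: a; b].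
Proof. by rewrite /block_word => ->. Qed.

Lemma block_le_trans : transitive block_le.
Proof. by move=> c b d; rewrite /block_le; lia. Qed.

Lemma block_chain_cons b bs :
  block_chain (b :: bs) = [&& b.1 <= b.2, path block_le b bs & block_chain bs].
Proof.
rewrite /block_chain /=; case: (b.1 <= b.2) => //=.
case: (boolP (path _ _ _)) => [/path_sorted-> | _]; first by rewrite andbT.
by rewrite andbF.
Qed.

Lemma head_word b bs : head 0 (word (b :: bs)) = b.2.
Proof. by rewrite /word /= /block_word; case: ifP. Qed.

Lemma all_word (P : pred nat) bs : all (fun b => b.1 <= b.2) bs ->
  all P (word bs) = all (fun b => P b.1 && P b.2) bs.
Proof.
rewrite /word; elim: bs => //= -[l h] bs IHbs /= /andP[le_lh /IHbs].
rewrite all_cat /block_word /= => ->; case: ltngtP le_lh => // [_|->] _ /=.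
  by rewrite andbT [P l && _]andbC.
by rewrite andbT andbb.
Qed.

Lemma word_ge b bs : path block_le b bs -> block_chain bs -> all (leq b.1) (word bs).
Proof.
move=> /(order_path_min block_le_trans)/allP bP /andP[le_bs _].
rewrite all_word //; apply/allP=> c cbs.
by move: (bP c cbs) (allP le_bs c cbs); rewrite /block_le; lia.
Qed.

Lemma head_word_ge b c bs : path block_le b (c :: bs) -> b.2 <= head 0 (word (c :: bs)).
Proof. by rewrite head_word /= /block_le => /andP[/andP[]]. Qed.

Lemma faro_word bs : block_chain bs -> faro (word bs).
Proof.
elim: bs => // b bs IHbs; rewrite block_chain_cons => /and3P[le_b b_bs bs_ch].
have ge_b := word_ge b_bs bs_ch; have {IHbs} fw := IHbs bs_ch.
have hd : word bs = [::] \/ b.2 <= head 0 (word bs).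
  case: bs b_bs {bs_ch fw ge_b} => [|c bs] b_bs; first by left.
  by right; apply: head_word_ge.
rewrite /word /= -/(word bs) /block_word.
case: ifP => lt_b /=; rewrite ?fw ?andbT.
  case: (word bs) ge_b hd {fw} => [|x s] //= /andP[_ ge_s] [//|->].
  by case: s ge_s => //= y s /andP[->].
have ->: b.2 = b.1 by lia.
by case: (word bs) ge_b {fw hd} => [|x [|y s]] //= /and3P[].
Qed.

(** The blocks are found from the right: a new first letter a stands alone,
    unless it exceeds the letter after it. That letter is then a singleton,
    since the low letter of a pair would come two positions after a, hence be
    at least a. *)
Lemma faro_wordP w : faro w -> exists2 bs, block_chain bs & w = word bs.
Proof.
elim: w => [|a w IHw] /=; first by exists [::].
case/andP=> aw fw; case: (IHw fw) => -[|[l h] bs] bs_ch wE.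
  exists [:: (a, a)]; first by rewrite /block_chain /= leqnn.
  by rewrite word_cons block_word_singleton wE.
move: (bs_ch); rewrite block_chain_cons => /= /and3P[le_lh b_bs bs'_ch].
have [le_al|lt_la] := leqP a l.
  exists ((a, a) :: (l, h) :: bs); last by rewrite word_cons block_word_singleton wE.
  by rewrite block_chain_cons /= b_bs bs_ch leqnn /block_le /=; lia.
have hl : h = l.
  apply/eqP; rewrite eqn_leq le_lh andbT leqNgt; apply/negP=> lt_lh.
  by move: aw; rewrite wE word_cons block_word_pair //= leqNgt lt_la.
subst h; rewrite word_cons block_word_singleton /= in wE.
exists ((l, a) :: bs); last by rewrite word_cons block_word_pair // wE.
rewrite block_chain_cons bs'_ch andbT /= ltnW //=.
case: bs b_bs aw wE {bs_ch bs'_ch} => //= c bs /andP[lc ->] aw wE.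
have : word (c :: bs) != [::] by rewrite word_cons /block_word; case: ifP.
have hd := head_word c bs; move: lc aw; rewrite wE /block_le /= -hd.
by case: (word (c :: bs)) => [|x s] //=; lia.
Qed.

(** * Counting singletons and pairs in a chain of blocks *)

Definition singles (bs : seq (nat * nat)) x := count_mem (x, x) bs.
Definition opens (bs : seq (nat * nat)) x :=
  count (fun b => (b.1 < b.2) && (b.1 == x)) bs.
Definition closes (bs : seq (nat * nat)) x :=
  count (fun b => (b.1 < b.2) && (b.2 == x)) bs.

Lemma count_iota_cons (P : pred nat) m :
  count P (iota 0 m.+1) = P 0 + count (fun i => P i.+1) (iota 0 m).
Proof. by rewrite /= -add1n iotaDl count_map. Qed.

Lemma nb_pairs_from_cons a w x :
  nb_pairs_from (a :: w) x = pair_at (a :: w) 0 && (a == x) + nb_pairs_from w x.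
Proof. by rewrite /nb_pairs_from [size _]/= count_iota_cons. Qed.

Lemma nb_pairs_to_cons a w x :
  nb_pairs_to (a :: w) x =
    pair_at (a :: w) 0 && (head 0 w == x) + nb_pairs_to w x.
Proof. by rewrite /nb_pairs_to [size _]/= count_iota_cons /= nth0. Qed.

Lemma nb_singletons_cons a w x : ~~ pair_at (a :: w) 0 ->
  nb_singletons (a :: w) x = (a == x) + nb_singletons w x.
Proof.
move=> npr; rewrite /nb_singletons [size _]/= count_iota_cons.
rewrite {1}/singleton_at npr /=; congr (_ + _); apply: eq_count => i.
rewrite /singleton_at [nth _ _ _]/= -[pair_at (a :: w) i.+1]/(pair_at w i).
by case: i => [|i]; rewrite /= ?(negbTE npr).
Qed.

(** The letter b of the pair a b is the only one outside w that could exclude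
    the first letter of w from being a singleton; hence the second premise. *)
Lemma nb_singletons_cons2 a b w x : b < a -> ~~ pair_at (b :: w) 0 ->
  nb_singletons (a :: b :: w) x = nb_singletons w x.
Proof.
move=> ba npr; have pr : pair_at (a :: b :: w) 0 by rewrite /pair_at /= ba.
rewrite /nb_singletons [size _]/= !count_iota_cons /singleton_at pr.
rewrite /= andbF /= !add0n; apply: eq_count => i.
rewrite -[pair_at (a :: b :: w) i.+2]/(pair_at w i).
rewrite -[pair_at (a :: b :: w) i.+1]/(pair_at (b :: w) i).
by case: i => [|i]; rewrite /= ?(negbTE npr).
Qed.

Lemma nb_word bs x : block_chain bs ->
  [/\ nb_singletons (word bs) x = singles bs x,
      nb_pairs_to (word bs) x = opens bs x
    & nb_pairs_from (word bs) x = closes bs x].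
Proof.
elim: bs => // -[l h] bs IHbs; rewrite block_chain_cons => /and3P[/= le_lh b_bs bs_ch].
have {IHbs}[IHs IHt IHf] := IHbs bs_ch.
have npr y : y <= h -> ~~ pair_at (y :: word bs) 0.
  move=> le_yh; rewrite /pair_at /= nth0 negb_and -!leqNgt.
  case: bs b_bs {bs_ch IHs IHt IHf} => [|c bs] // /head_word_ge /= le_h.
  by rewrite (leq_trans le_yh le_h) orbT.
rewrite /word /= -/(word bs) /block_word /singles /opens /closes /=.
have [lt_lh | le_hl] := ltnP l h => /=.
  have npl := npr l le_lh.
  have pr : pair_at (h :: l :: word bs) 0 by rewrite /pair_at /= lt_lh.
  rewrite nb_singletons_cons2 // !nb_pairs_to_cons !nb_pairs_from_cons.
  rewrite pr (negbTE npl) /= IHs IHt IHf !add0n; split=> //.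
  by have -> : ((l, h) == (x, x)) = false by rewrite xpair_eqE; lia.
have -> : h = l by lia.
have npl := npr l le_lh.
rewrite nb_singletons_cons // nb_pairs_to_cons nb_pairs_from_cons (negbTE npl).
by rewrite IHs IHt IHf xpair_eqE andbb.
Qed.

(** The letter x is the low letter of a block either as a singleton or as the
    low letter of a pair. *)
Lemma count_lows bs x : all (fun b => b.1 <= b.2) bs ->
  count_mem x (unzip1 bs) = singles bs x + opens bs x.
Proof.
rewrite /singles /opens.
elim: bs => //= -[l h] bs IHbs /= /andP[le_lh /IHbs ->].
by rewrite xpair_eqE; lia.
Qed.

Lemma count_highs bs x : all (fun b => b.1 <= b.2) bs ->
  count_mem x (unzip2 bs) = singles bs x + closes bs x.
Proof.
rewrite /singles /closes.
elim: bs => //= -[l h] bs IHbs /= /andP[le_lh /IHbs ->].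
by rewrite xpair_eqE; lia.
Qed.

Lemma count_word bs x : all (fun b => b.1 <= b.2) bs ->
  count_mem x (word bs) = singles bs x + opens bs x + closes bs x.
Proof.
rewrite /singles /opens /closes /word.
elim: bs => //= -[l h] bs IHbs /= /andP[le_lh /IHbs].
rewrite count_cat => ->; rewrite xpair_eqE /block_word /=.
by case: ltnP => /=; lia.
Qed.

Lemma sorted_block_le bs :
  sorted block_le bs = sorted leq (unzip1 bs) && sorted leq (unzip2 bs).
Proof.
case: bs => //= b bs; elim: bs b => //= c bs IHbs b.
by rewrite IHbs /block_le; case: (b.1 <= c.1); case: (b.2 <= c.2); rewrite /= ?andbF.
Qed.

(** A sorted sequence is determined by its multiplicities, and a chain is the
    zip of its two sorted sequences of coordinates. *)
Lemma block_chain_inj bs cs : block_chain bs -> block_chain cs ->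
  (forall x, [/\ singles bs x = singles cs x, opens bs x = opens cs x
               & closes bs x = closes cs x]) -> bs = cs.
Proof.
rewrite /block_chain !sorted_block_le.
move=> /and3P[le_bs sb1 sb2] /and3P[le_cs sc1 sc2] eq_bc.
rewrite -[bs]zip_unzip -[cs]zip_unzip; congr zip.
  apply: (sorted_eq leq_trans anti_leq) => //; apply/allP => x _ /=.
  by rewrite !count_lows //; have [-> -> _] := eq_bc x.
apply: (sorted_eq leq_trans anti_leq) => //; apply/allP => x _ /=.
by rewrite !count_highs //; have [-> _ ->] := eq_bc x.
Qed.

(** * Dispersed Dyck paths *)

(** The dispersed Dyck condition for the rest of a path that has already
    reached height h. *)
Fixpoint dyck_from (h : nat) (p : seq step) : bool :=
  match p with
  | [::] => h == 0
  | F :: p' => (h == 0) && dyck_from h p'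
  | U :: p' => dyck_from h.+1 p'
  | D :: p' => (0 < h) && dyck_from h.-1 p'
  end.

Lemma endpoint_cons s p :
  ((endpoint (s :: p)).1 = (step_vec s).1 + (endpoint p).1)%R /\
  ((endpoint (s :: p)).2 = (step_vec s).2 + (endpoint p).2)%R.
Proof. by rewrite /endpoint big_cons. Qed.

Lemma endpoint_nil : endpoint [::] = (0, 0)%R.
Proof. by rewrite /endpoint big_nil. Qed.

Lemma endpoint1 p : ((endpoint p).1 = (size p)%:Z)%R.
Proof.
elim: p => [|s p IHp]; first by rewrite endpoint_nil.
by have [-> _] := endpoint_cons s p; rewrite IHp; case: s => /=; lia.
Qed.

(** Reading a step s from height h leads to the height of [shift], which carries
    all three conditions from p to s :: p. *)
Lemma dyck_fromP h p :
  dyck_from h p <->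
  [/\ (h%:Z + (endpoint p).2 = 0)%R,
      forall i, i <= size p -> (0 <= h%:Z + (endpoint (take i p)).2)%R
    & forall i, i < size p -> nth F p i = F ->
        (h%:Z + (endpoint (take i p)).2 = 0)%R].
Proof.
elim: p h => [|s p IHp] h /=.
  rewrite endpoint_nil /=; split=> [/eqP-> | []]; last by lia.
  by split=> //= i; rewrite endpoint_nil.
have sumE q : ((endpoint (s :: q)).2 = (step_vec s).2 + (endpoint q).2)%R.
  by have [] := endpoint_cons s q.
have shift h' : (h'%:Z = h%:Z + (step_vec s).2)%R ->
    (s = F -> h = 0) ->
    dyck_from h' p <->
    [/\ (h%:Z + (endpoint (s :: p)).2 = 0)%R,
        forall i, i <= (size p).+1 ->
          (0 <= h%:Z + (endpoint (take i (s :: p))).2)%R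
      & forall i, i < (size p).+1 -> nth F (s :: p) i = F ->
          (h%:Z + (endpoint (take i (s :: p))).2 = 0)%R].
  move=> hE sF; rewrite IHp hE sumE; split=> -[H1 H2 H3]; split.
  - by rewrite -H1; lia.
  - case=> [|i] lei /=; first by rewrite endpoint_nil /=; lia.
    by rewrite sumE; move: (H2 i lei); lia.
  - case=> [|i] lei /=; first by rewrite endpoint_nil /= => /sF; lia.
    by rewrite sumE => /(H3 i lei); lia.
  - by rewrite -H1; lia.
  - by move=> i lei; move: (H2 i.+1 lei); rewrite /= sumE; lia.
  - by move=> i lei Fi; move: (H3 i.+1 lei Fi); rewrite /= sumE; lia.
case: s sumE shift => sumE shift.
- split=> [/andP[/eqP h0 dp] | H].
    by apply/(shift h); rewrite ?h0 //= -?h0.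
  have h0 : h = 0.
    by case: H => _ _ /(_ 0 isT erefl); rewrite /= endpoint_nil /=; lia.
  by rewrite h0 /= -{1}h0; apply/(shift h); rewrite ?h0 //= -?h0.
- by apply: shift => //=; lia.
- split=> [/andP[h_gt0 dp] | H].
    by apply/(shift h.-1) => //=; lia.
  have h_gt0 : 0 < h.
    case: H => _ /(_ 1 isT) + _.
    by rewrite /= take0 sumE endpoint_nil /=; lia.
  by rewrite h_gt0; apply/(shift h.-1) => //=; lia.
Qed.

Lemma dispersed_dyck_pathsP m r p :
  dispersed_dyck_paths m r p <->
  [/\ dyck_from 0 p, size p = m & nb_peaks p = r].
Proof.
have eqd := dyck_fromP 0 p; split.
  case=> ep H2 H3 pk; split=> //.
    apply/eqd; rewrite ep; split=> // i.
      by move=> /H2; rewrite GRing.add0r.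
    by move=> lei /(H3 i lei); rewrite GRing.add0r.
  by move: (endpoint1 p); rewrite ep /= => -[].
case=> /eqd[H1 H2 H3] sz pk; split=> //.
- by rewrite (surjective_pairing (endpoint p)) endpoint1 sz; congr pair; lia.
- by move=> i /H2; rewrite GRing.add0r.
- by move=> i lei /(H3 i lei); rewrite GRing.add0r.
Qed.

(** * Run lengths of a path *)

(** The runs of U and D are never empty, so b and c count their steps beyond the
    first one; the path then has one peak per triple and no others. *)
Fixpoint run_path (q : seq (nat * nat * nat)) (z : nat) : seq step :=
  if q is (a, b, c) :: q' then
    nseq a F ++ nseq b.+1 U ++ nseq c.+1 D ++ run_path q' z
  else nseq z F.

(** The height at which the remaining path starts. The first steps of a run of U
    and of the next run of D cancel, which makes c <= h + b the condition for
    staying above the axis. *)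
Fixpoint run_valid (h : nat) (q : seq (nat * nat * nat)) : bool :=
  if q is (a, b, c) :: q' then
    [&& (0 < a) ==> (h == 0), c <= h + b & run_valid (h + b - c) q']
  else h == 0.

Lemma dyck_from_nseqF h a p :
  dyck_from h (nseq a F ++ p) = ((0 < a) ==> (h == 0)) && dyck_from h p.
Proof. by elim: a => //= a ->; case: a => [|a] //=; case: eqP. Qed.

Lemma dyck_from_nseqU h b p : dyck_from h (nseq b U ++ p) = dyck_from (h + b) p.
Proof. by elim: b h => [|b IHb] h /=; rewrite ?addn0 // IHb addSnnS. Qed.

Lemma dyck_from_nseqD h c p :
  dyck_from h (nseq c D ++ p) = (c <= h) && dyck_from (h - c) p.
Proof.
elim: c h => [|c IHc] [|h] //=; rewrite ?subn0 //.
Qed.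

Lemma dyck_from_run_path h q z : run_valid h q -> dyck_from h (run_path q z).
Proof.
elim: q h => [|[[a b] c] q IHq] h /=.
  by move=> /eqP->; rewrite -[nseq z F]cats0 dyck_from_nseqF eqxx implybT.
case/and3P=> a0 le_c /IHq dq.
rewrite dyck_from_nseqF a0 /= dyck_from_nseqU /= dyck_from_nseqD.
by rewrite le_c dq.
Qed.

Lemma run_path_valid h q z : dyck_from h (run_path q z) -> run_valid h q.
Proof.
elim: q h => [|[[a b] c] q IHq] h /=.
  by rewrite -[nseq z F]cats0 dyck_from_nseqF /= => /andP[].
rewrite dyck_from_nseqF => /andP[-> /=]; rewrite dyck_from_nseqU.
by rewrite /= dyck_from_nseqD => /andP[-> /IHq].
Qed.

(** The leading run of D makes the statement stable under removal of the first
    step: the rest of a path that starts with U may itself start with D. *)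
Lemma dyck_from_runs h p : dyck_from h p ->
  exists c q z, p = nseq c D ++ run_path q z.
Proof.
elim: p h => [|s p IHp] h; first by exists 0, [::], 0.
case: s => /=.
- case/andP=> /eqP-> dp; have [[|c] [q [z pE]]] := IHp _ dp.
    exists 0; case: q pE => [|[[a b] c] q] pE.
      by exists [::], z.+1; rewrite pE.
    by exists ((a.+1, b, c) :: q), z; rewrite pE.
  by rewrite pE in dp.
- move=> dp; have [[|c] [q [z pE]]] := IHp _ dp; last first.
    by exists 0, ((0, 0, c) :: q), z; rewrite pE.
  (* at positive height p starts with U, and its first run of U gets longer *)
  case: q pE => [|[[[|a] b] c] q] pE; last by rewrite pE in dp.
    by rewrite pE in dp; case: z dp {pE}.
  by exists 0, ((0, b.+1, c) :: q), z; rewrite pE.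
- case/andP=> _ dp; have [c [q [z pE]]] := IHp _ dp.
  by exists c.+1, q, z; rewrite pE.
Qed.

Lemma dyck_runs p : dyck_from 0 p -> exists q z, p = run_path q z.
Proof.
move=> dp; have [[|c] [q [z pE]]] := dyck_from_runs dp; first by exists q, z.
by rewrite pE in dp.
Qed.

Lemma nb_peaks_cons s p :
  nb_peaks (s :: p) =
    (if (s, head F p) is (U, D) then true else false) + nb_peaks p.
Proof. by case: p => [|t p]; case: s => //; case: t. Qed.

Lemma nb_peaks_run_path q z : nb_peaks (run_path q z) = size q.
Proof.
elim: q => [|[[a b] c] q IHq] /=; first by elim: z => //= z; rewrite nb_peaks_cons.
elim: a => [|a IHa]; last by rewrite /= nb_peaks_cons IHa.
elim: b => [|b IHb]; last by rewrite /= nb_peaks_cons -[RHS]IHb.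
rewrite /= nb_peaks_cons /= add1n; congr _.+1.
by elim: c => [|c IHc]; rewrite /= nb_peaks_cons.
Qed.

Lemma nseq_cat_inj (x : step) a b p q :
  nseq a x ++ p = nseq b x ++ q -> ohead p <> Some x -> ohead q <> Some x ->
  a = b /\ p = q.
Proof.
elim: a b => [|a IHa] [|b] //=.
- by move=> ->.
- by move=> <-.
- by case=> /IHa IH p_x q_x; have [-> ->] := IH p_x q_x.
Qed.

Lemma run_path_inj q z q' z' : run_path q z = run_path q' z' -> q = q' /\ z = z'.
Proof.
have headND r y : ohead (run_path r y) <> Some D.
  by case: r => [|[[[|a] b] c] r]; case: y.
elim: q q' => [|[[a b] c] q IHq] [|[[a' b'] c'] q'] /=.
- rewrite -[nseq z F]cats0 -[nseq z' F]cats0.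
  by case/nseq_cat_inj=> // -> _.
- by rewrite -[nseq z F]cats0; case/nseq_cat_inj.
- by rewrite -[nseq z' F]cats0; case/nseq_cat_inj.
case/nseq_cat_inj=> // <- [] /nseq_cat_inj[] // <- [] /nseq_cat_inj[] // <-.
by case/IHq=> <- <-.
Qed.

Lemma size_run_path_cons a b c q z :
  size (run_path ((a, b, c) :: q) z) = a + b + c + 2 + size (run_path q z).
Proof. by rewrite /= size_cat /= size_cat /= size_cat !size_nseq; lia. Qed.

(** * From chains of blocks to dispersed Dyck paths *)

Definition profile (bs : seq (nat * nat)) x m : seq (nat * nat * nat) :=
  [seq (singles bs y, opens bs y, closes bs y.+1) | y <- iota x m].

Lemma profileS bs x m :
  profile bs x m.+1 =
    (singles bs x, opens bs x, closes bs x.+1) :: profile bs x.+1 m.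
Proof. by []. Qed.

Lemma faro_map_word k bs : block_chain bs -> 1 <= k ->
  faro_map k (word bs) = run_path (profile bs 1 (k - 1)) (singles bs k).
Proof.
move=> bs_ch k_gt0.
have T0 j : T (word bs) (3 * j) = singles bs j.+1.
  by rewrite /T modnMr mulKn //; have [] := nb_word j.+1 bs_ch.
have T1 j : T (word bs) (3 * j + 1) = (opens bs j.+1).+1.
  rewrite /T mulnC modnMDl divnMDl // addn0.
  by have [_ ->] := nb_word j.+1 bs_ch.
have T2 j : T (word bs) (3 * j + 2) = (closes bs j.+2).+1.
  rewrite /T mulnC modnMDl divnMDl // addn0.
  by have [_ _ ->] := nb_word j.+2 bs_ch.
rewrite /faro_map T0 (_ : (k - 1).+1 = k); last by lia.
suff path_from m j z :
    flatten [seq nseq (T (word bs) (3 * i)) F ++ nseq (T (word bs) (3 * i + 1)) U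
                   ++ nseq (T (word bs) (3 * i + 2)) D | i <- iota j m] ++ nseq z F
    = run_path (profile bs j.+1 m) z by exact: path_from.
elim: m j => //= m IHm j.
by rewrite T0 T1 T2 -!catA IHm.
Qed.

(** The height of the path of [bs] before the run of F that belongs to x. *)
Definition straddling (bs : seq (nat * nat)) x :=
  count (fun b => b.1 < x < b.2) bs.

(** Both sides count the pairs with lo <= x < hi. *)
Lemma straddlingS bs x :
  straddling bs x.+1 + closes bs x.+1 = straddling bs x + opens bs x.
Proof.
rewrite /straddling /closes /opens; elim: bs => //= -[l h] bs /= IHbs.
set s1 := count _ bs in IHbs *; set s2 := count _ bs in IHbs *.
set s3 := count _ bs in IHbs *; set s4 := count _ bs in IHbs *.
suff : (l < x.+1 < h) + ((l < h) && (h == x.+1)) = (l < x < h) + ((l < h) && (l == x)).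
  by move: IHbs; lia.
lia.
Qed.

Lemma singleton_not_straddled bs x : block_chain bs ->
  0 < singles bs x -> straddling bs x = 0.
Proof.
rewrite /singles /straddling -has_count has_pred1.
elim: bs => // b bs IHbs; rewrite block_chain_cons => /and3P[le_b b_bs bs_ch].
have /allP le_bbs := order_path_min block_le_trans b_bs.
rewrite inE => /orP[/eqP eb | xbs] /=.
  rewrite -eb /= ltnn add0n; apply/eqP; rewrite -leqn0 leqNgt -has_count.
  by apply/hasPn=> c /le_bbs; rewrite -eb /block_le /=; lia.
rewrite IHbs //; move: (le_bbs _ xbs); rewrite /block_le /=.
by case: (ltnP x b.2) => /=; lia.
Qed.

Lemma run_valid_profile bs x m : block_chain bs -> straddling bs (x + m) = 0 ->
  run_valid (straddling bs x) (profile bs x m).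
Proof.
move=> bs_ch; elim: m x => [|m IHm] x /=; first by rewrite addn0 => ->.
rewrite addnS -addSn => /IHm vm; have xS := straddlingS bs x; apply/and3P; split.
- by apply/implyP=> /(singleton_not_straddled bs_ch) ->.
- by lia.
- by rewrite (_ : _ - _ = straddling bs x.+1) //; lia.
Qed.

Lemma size_sum_count_mem (s : seq nat) x m : all (fun y => x <= y < x + m) s ->
  size s = \sum_(y <- iota x m) count_mem y s.
Proof.
elim: s => [|a s IHs] /=; first by rewrite big1_eq.
case/andP=> a_in /IHs ->; rewrite big_split /= -add1n; congr (_ + _).
have := count_uniq_mem a (iota_uniq x m); rewrite mem_iota a_in /= => <-.
by rewrite -sum1_count big_mkcond; apply: eq_bigr => y _ /=; rewrite eq_sym; case: eqP.
Qed.

(** The pairs with high letter x, and those with low letter x + m, are counted by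
    the letters of the range but not by the runs of the path. *)
Lemma size_run_path_profile bs x m : all (fun b => b.1 <= b.2) bs ->
  size (run_path (profile bs x m) (singles bs (x + m)))
    + closes bs x + opens bs (x + m) =
  \sum_(y <- iota x m.+1) count_mem y (word bs) + 2 * m.
Proof.
move=> le_bs; elim: m x => [|m IHm] x.
  by rewrite big_seq1 /= size_nseq addn0 count_word //; lia.
rewrite addnS -addSn profileS size_run_path_cons.
rewrite -[iota x _]/(x :: iota x.+1 m.+1) big_cons count_word //.
by have := IHm x.+1; lia.
Qed.

Lemma kary_word k bs : all (fun b => b.1 <= b.2) bs ->
  kary k (word bs) = all (fun b => (1 <= b.1 <= k) && (1 <= b.2 <= k)) bs.
Proof. exact: all_word. Qed.

Lemma count_eq0_in (A : eqType) (P : pred A) s :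
  (forall y, y \in s -> ~~ P y) -> count P s = 0.
Proof. by move=> nP; apply/eqP; rewrite -leqn0 leqNgt -has_count; apply/hasPn. Qed.

(** In a k-ary word no pair has high letter 1 or low letter k, so the boundary
    terms of [size_run_path_profile] vanish. *)
Lemma size_faro_map k bs : 1 <= k -> block_chain bs -> kary k (word bs) ->
  size (faro_map k (word bs)) = size (word bs) + 2 * (k - 1).
Proof.
move=> k_gt0 bs_ch kw; have /andP[le_bs _] := bs_ch.
rewrite (size_sum_count_mem (x := 1) (m := k)); last first.
  by apply: sub_all kw => y; lia.
have := size_run_path_profile 1 (k - 1) le_bs.
rewrite faro_map_word // subnKC // (_ : (k - 1).+1 = k); last by lia.
move: kw; rewrite kary_word // => /allP kw.
rewrite {1}/opens {1}/closes !count_eq0_in ?addn0 // => b /kw; lia.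
Qed.

Lemma dyck_from_faro_map k bs : 1 <= k -> block_chain bs -> kary k (word bs) ->
  dyck_from 0 (faro_map k (word bs)).
Proof.
move=> k_gt0 bs_ch; have /andP[le_bs _] := bs_ch; rewrite kary_word // => /allP kw.
have st x : (x == 1) || (x == k) -> straddling bs x = 0.
  by move=> xE; apply: count_eq0_in => b /kw; lia.
rewrite faro_map_word //; apply: dyck_from_run_path.
have := @run_valid_profile bs 1 (k - 1) bs_ch.
by rewrite subnKC // !st ?eqxx ?orbT //; apply.
Qed.

Lemma faro_map_word_inj k bs cs : 1 <= k -> block_chain bs -> block_chain cs ->
  kary k (word bs) -> kary k (word cs) ->
  faro_map k (word bs) = faro_map k (word cs) -> bs = cs.
Proof.
move=> k_gt0 bs_ch cs_ch kb kc; rewrite !faro_map_word //.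
case/run_path_inj=> prof_bc singles_k.
have /andP[le_bs _] := bs_ch; have /andP[le_cs _] := cs_ch.
have {prof_bc} eq_in y : 1 <= y < k -> [/\ singles bs y = singles cs y,
    opens bs y = opens cs y & closes bs y.+1 = closes cs y.+1].
  move=> y_in; have lt_y : y.-1 < k - 1 by lia.
  have := congr1 (fun s => nth (0, 0, 0) s y.-1) prof_bc.
  rewrite !(nth_map 0) ?size_iota // !nth_iota // add1n prednK; last by lia.
  by case.
(* outside the range of the profile all counts of a k-ary chain vanish *)
have out ds y : all (fun b => b.1 <= b.2) ds -> kary k (word ds) ->
    [/\ ~~ (1 <= y <= k) -> singles ds y = 0, ~~ (1 <= y < k) -> opens ds y = 0
      & ~~ (1 < y <= k) -> closes ds y = 0].
  move=> le_ds; rewrite kary_word // => /allP kd; split=> y_out.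
  - by apply: count_eq0_in => -[l h] /kd /=; rewrite xpair_eqE; lia.
  - by apply: count_eq0_in => -[l h] /kd /=; lia.
  - by apply: count_eq0_in => -[l h] /kd /=; lia.
apply: block_chain_inj => // y.
have [sb ob cb] := out bs y le_bs kb; have [sc oc cc] := out cs y le_cs kc.
split.
- have [->//|y_k] := eqVneq y k.
  case: (boolP (1 <= y <= k)) => y_in; last by rewrite sb ?sc.
  by have [|->] := eq_in y; first by lia.
- case: (boolP (1 <= y < k)) => y_in; last by rewrite ob ?oc.
  by have [_ ->] := eq_in y y_in.
- case: (boolP (1 < y <= k)) => y_in; last by rewrite cb ?cc.
  have [|_ _] := eq_in y.-1; first by lia.
  by rewrite prednK //; lia.
Qed.

(** * From dispersed Dyck paths to chains of blocks *)

(** The queue Q holds the low letters of the pairs that are still open, oldest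
    first. The new letters x enter it before the c oldest letters leave it with
    high letter x + 1. *)
Fixpoint queue_blocks (Q : seq nat) x (q : seq (nat * nat * nat)) z :=
  if q is (a, b, c) :: q' then
    nseq a (x, x) ++ [seq (y, x.+1) | y <- take c (Q ++ nseq b x)]
      ++ queue_blocks (drop c (Q ++ nseq b x)) x.+1 q' z
  else nseq z (x, x).

(** The coordinates of the blocks of [queue_blocks]: first-in first-out order
    makes them independent of how opened and closed pairs are matched, and
    visibly sorted. *)
Fixpoint lows x (q : seq (nat * nat * nat)) z :=
  if q is (a, b, _) :: q' then nseq (a + b) x ++ lows x.+1 q' z else nseq z x.

Fixpoint highs x (q : seq (nat * nat * nat)) z :=
  if q is (a, _, c) :: q' then nseq a x ++ nseq c x.+1 ++ highs x.+1 q' z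
  else nseq z x.

(** Validity is what allows reordering: the queue is empty whenever singletons
    are emitted, so these do not overtake waiting low letters. *)
Lemma unzip_queue_blocks Q x q z : run_valid (size Q) q ->
  unzip1 (queue_blocks Q x q z) = Q ++ lows x q z /\
  unzip2 (queue_blocks Q x q z) = highs x q z.
Proof.
rewrite /unzip1 /unzip2.
elim: q Q x => [|[[a b] c] q IHq] Q x /=.
  by move/eqP/size0nil->; rewrite !map_nseq.
case/and3P=> a0 le_c vq; set Q' := Q ++ _.
have szQ' : size Q' = size Q + b by rewrite size_cat size_nseq.
have [|IH1 IH2] := IHq (drop c Q') x.+1; first by rewrite size_drop szQ'.
rewrite !map_cat !map_nseq -!map_comp IH1 IH2; split.
  rewrite map_id_in // [_ ++ (_ ++ lows _ _ _)]catA cat_take_drop /Q' nseqD -!catA.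
  by case: a a0 => //= a /eqP/size0nil->.
congr (_ ++ (_ ++ _)); rewrite -[in RHS](@size_takel c _ Q') ?szQ' //.
by elim: (take _ _) => //= y s ->.
Qed.

Lemma lows_range x q z : all (fun y => x <= y <= x + size q) (lows x q z).
Proof.
elim: q x => [|[[a b] c] q IHq] x /=; first by rewrite all_nseq; lia.
rewrite all_cat all_nseq; apply/andP; split; first by lia.
by apply: sub_all (IHq x.+1) => y; lia.
Qed.

Lemma highs_range x q z : all (fun y => x <= y <= x + size q) (highs x q z).
Proof.
elim: q x => [|[[a b] c] q IHq] x /=; first by rewrite all_nseq; lia.
rewrite !all_cat !all_nseq; apply/and3P; split; [lia | lia |].
by apply: sub_all (IHq x.+1) => y; lia.
Qed.

Lemma sorted_nseq_cat x m s : all (leq x) s -> sorted leq s ->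
  sorted leq (nseq m x ++ s).
Proof.
move=> xs ss; elim: m => //= m; case: m => [|m] /= ; last by rewrite leqnn.
by case: s xs ss => //= y s /andP[-> _].
Qed.

Lemma sorted_lows x q z : sorted leq (lows x q z).
Proof.
elim: q x => [|[[a b] c] q IHq] x /=.
  by rewrite -[nseq _ _]cats0 sorted_nseq_cat.
by apply: sorted_nseq_cat => //; apply: sub_all (lows_range _ _ _) => y; lia.
Qed.

Lemma sorted_highs x q z : sorted leq (highs x q z).
Proof.
elim: q x => [|[[a b] c] q IHq] x /=.
  by rewrite -[nseq _ _]cats0 sorted_nseq_cat.
have hx := highs_range x.+1 q z.
apply: sorted_nseq_cat; last first.
  by apply: sorted_nseq_cat => //; apply: sub_all hx => y; lia.
rewrite all_cat all_nseq leqnSn orbT /=.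
by apply: sub_all hx => y; lia.
Qed.

Lemma queue_step (Q : seq nat) x b c : all (fun y => y < x) Q ->
  all (fun y => y < x.+1) (take c (Q ++ nseq b x)) /\
  all (fun y => y < x.+1) (drop c (Q ++ nseq b x)).
Proof.
move=> Qx; apply/andP; rewrite -all_cat cat_take_drop all_cat all_nseq ltnSn orbT andbT.
by apply: sub_all Qx => y; lia.
Qed.

Lemma queue_blocks_le Q x q z : all (fun y => y < x) Q ->
  all (fun b => b.1 <= b.2) (queue_blocks Q x q z).
Proof.
elim: q Q x => [|[[a b] c] q IHq] Q x Qx /=; first by rewrite all_nseq /= leqnn orbT.
have [tQ dQ] := queue_step b c Qx; rewrite !all_cat IHq // all_nseq /= leqnn orbT andbT.
by rewrite all_map; apply: sub_all tQ => y /=; lia.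
Qed.

Lemma block_chain_queue_blocks x q z : run_valid 0 q ->
  block_chain (queue_blocks [::] x q z).
Proof.
move=> vq; rewrite /block_chain queue_blocks_le //= sorted_block_le.
have [|-> ->] := @unzip_queue_blocks [::] x q z; first by [].
by rewrite sorted_lows sorted_highs.
Qed.

Lemma kary_word_queue_blocks q z : run_valid 0 q ->
  kary (size q).+1 (word (queue_blocks [::] 1 q z)).
Proof.
move=> vq; rewrite kary_word ?queue_blocks_le //.
have [|u1 u2] := @unzip_queue_blocks [::] 1 q z; first by [].
have := highs_range 1 q z; have := lows_range 1 q z.
rewrite -{}u2 -[lows _ _ _]/([::] ++ _) -{}u1 /unzip1 /unzip2 !all_map => l_in h_in.
by rewrite all_predI l_in.
Qed.

Lemma count_nseq_block a x y :
  [/\ singles (nseq a (x, x)) y = (x == y) * a, opens (nseq a (x, x)) y = 0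
    & closes (nseq a (x, x)) y = 0].
Proof. by rewrite /singles /opens /closes !count_nseq /= xpair_eqE andbb ltnn. Qed.

Lemma count_map_block s x y : all (fun v => v < x) s ->
  let bs := [seq (v, x) | v <- s] in
  [/\ singles bs y = 0, opens bs y = count_mem y s & closes bs y = (x == y) * size s].
Proof.
move=> /allP s_lt bs; rewrite /singles /opens /closes /bs !count_map; split.
- by apply: count_eq0_in => v /s_lt /=; rewrite xpair_eqE; lia.
- by apply: eq_in_count => v /s_lt /= ->.
- rewrite (eq_in_count (a2 := fun=> x == y)); last by move=> v /s_lt /= ->.
  by case: eqP => _; rewrite ?count_predT ?mul1n // count_pred0.
Qed.

Lemma count_queue_blocks_cons Q x a b c q z y :
  all (fun v => v < x) Q -> run_valid (size Q) ((a, b, c) :: q) ->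
  let rest := queue_blocks (drop c (Q ++ nseq b x)) x.+1 q z in
  [/\ singles (queue_blocks Q x ((a, b, c) :: q) z) y = (x == y) * a + singles rest y,
      opens (queue_blocks Q x ((a, b, c) :: q) z) y =
        count_mem y (take c (Q ++ nseq b x)) + opens rest y
    & closes (queue_blocks Q x ((a, b, c) :: q) z) y = (x.+1 == y) * c + closes rest y].
Proof.
move=> Qx /= /and3P[_ le_c _]; have [tQ _] := queue_step b c Qx.
have [s1 o1 c1] := count_nseq_block a x y.
have [s2 o2 c2] := count_map_block y tQ.
rewrite size_takel ?size_cat ?size_nseq // in c2.
move: s1 o1 c1 s2 o2 c2; rewrite /singles /opens /closes !count_cat.
by move=> -> -> -> -> -> ->.
Qed.

(** The blocks still to come involve letters below x only through the low letters
    that wait in the queue. *)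
Lemma count_queue_blocks_small Q x q z y :
  all (fun v => v < x) Q -> run_valid (size Q) q ->
  [/\ y < x -> singles (queue_blocks Q x q z) y = 0,
      y < x -> opens (queue_blocks Q x q z) y = count_mem y Q
    & y <= x -> closes (queue_blocks Q x q z) y = 0].
Proof.
elim: q Q x => [|[[a b] c] q IHq] Q x Qx vq.
  have [s1 o1 c1] := count_nseq_block z x y.
  rewrite /= s1 o1 c1; split=> // [y_x|_]; first by case: eqP y_x => //; lia.
  by move: vq => /= /eqP/size0nil->.
have [-> -> ->] := count_queue_blocks_cons z y Qx vq.
have [tQ dQ] := queue_step b c Qx.
move: vq => /= /and3P[_ _ vq].
have [|IHs IHo IHc] := IHq (drop c (Q ++ nseq b x)) x.+1 dQ.
  by rewrite size_drop size_cat size_nseq.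
split=> le_y.
- by rewrite IHs ?(gtn_eqF le_y) //; lia.
- rewrite IHo; last by lia.
  by rewrite -count_cat cat_take_drop count_cat count_nseq /= (gtn_eqF le_y) addn0.
- by rewrite IHc ?gtn_eqF //; lia.
Qed.

Lemma profile_queue_blocks Q x q z :
  all (fun v => v < x) Q -> run_valid (size Q) q ->
  profile (queue_blocks Q x q z) x (size q) = q /\
  singles (queue_blocks Q x q z) (x + size q) = z.
Proof.
elim: q Q x => [|[[a b] c] q IHq] Q x Qx vq.
  by have [s1 _ _] := count_nseq_block z x x; rewrite addn0 /= s1 eqxx mul1n.
have cnt y := count_queue_blocks_cons z y Qx vq.
have [tQ dQ] := queue_step b c Qx.
have vq' : run_valid (size (drop c (Q ++ nseq b x))) q.
  by move: vq => /= /and3P[_ _]; rewrite size_drop size_cat size_nseq.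
have small y := count_queue_blocks_small z y dQ vq'.
have [IHp IHz] := IHq _ x.+1 dQ vq'.
set bs := queue_blocks Q _ _ _ in cnt *.
set cs := queue_blocks _ _ _ _ in cnt small IHp IHz.
split; last first.
  by rewrite /= addnS -addSn; have [-> _ _] := cnt (x.+1 + size q);
     rewrite IHz ltn_eqF //; lia.
rewrite profileS; congr (_ :: _).
  have [-> -> _] := cnt x; have [_ _ ->] := cnt x.+1.
  have [-> // -> // _] := small x; have [_ _ -> //] := small x.+1.
  rewrite !eqxx !mul1n.
  rewrite -count_cat cat_take_drop count_cat count_nseq /= eqxx mul1n !addn0.
  by rewrite (count_eq0_in (s := Q)) // => y /(allP Qx) /=; lia.
rewrite -[RHS]IHp; apply/eq_in_map => y; rewrite mem_iota => /andP[lt_xy _].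
have [-> -> _] := cnt y; have [_ _ ->] := cnt y.+1.
rewrite eqSS (ltn_eqF lt_xy) !mul0n.
by rewrite (count_eq0_in (s := take _ _)) // => v /(allP tQ) /=; lia.
Qed.

(** * The bijection *)

Lemma faro_wordsP n k w : faro_words n k w <->
  exists bs, [/\ block_chain bs, w = word bs, kary k w & size w = n].
Proof.
split=> [[u [v [[ku kv] [su sv] sz -> szn]]] | [bs [bs_ch wE kw szn]]].
  have [bs bs_ch wE] := faro_wordP (faro_interlace sz su sv).
  by exists bs; split=> //; rewrite /kary all_interlace; apply/andP.
have := faro_word bs_ch; rewrite -wE => /faro_interlaceP[u [v [sz su sv uvE]]].
exists u, v; split=> //.
by move: kw; rewrite uvE /kary all_interlace => /andP.
Qed.

Theorem theorem2p7 (n k : nat) (hk : 1 <= k) :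
  set_bij (faro_words n k) (dispersed_dyck_paths (n + 2 * (k - 1)) (k - 1))
          (faro_map k).
Proof.
split.
- move=> w /faro_wordsP[bs [bs_ch wE kw <-]]; apply/dispersed_dyck_pathsP.
  rewrite wE in kw *.
  rewrite dyck_from_faro_map // size_faro_map //; split=> //.
  by rewrite faro_map_word // nb_peaks_run_path size_map size_iota.
- move=> w w'; rewrite !inE.
  move=> /faro_wordsP[bs [bs_ch wE kw _]] /faro_wordsP[cs [cs_ch wE' kw' _]].
  by rewrite wE wE' in kw kw' * => /faro_map_word_inj->.
- move=> p /dispersed_dyck_pathsP[dp szp pk].
  have [q [z pE]] := dyck_runs dp.
  have vq : run_valid 0 q by rewrite pE in dp; apply: run_path_valid dp.
  have szq : size q = k - 1 by rewrite -pk pE nb_peaks_run_path.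
  set bs := queue_blocks [::] 1 q z.
  have bs_ch : block_chain bs by apply: block_chain_queue_blocks.
  have kw : kary k (word bs).
    by rewrite (_ : k = (size q).+1) ?kary_word_queue_blocks //; lia.
  have mapE : faro_map k (word bs) = p.
    have [|pr sk] := @profile_queue_blocks [::] 1 q z isT; first by [].
    by rewrite faro_map_word // -szq pr pE (_ : k = 1 + size q) ?sk //; lia.
  exists (word bs) => //; apply/faro_wordsP; exists bs; split=> //.
  by have := size_faro_map hk bs_ch kw; rewrite mapE szp; lia.
Qed.
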